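(* Let $a,b,c,d\in\mathbb{R}$ with $ad-bc=1$ and $b\neq 0$, and let $x\in\ell^2(\mathbb{Z})$ be a nonzero (complex-valued) signal with finite support of support length $N$. Let $(\gamma_j,\overline{\gamma_j}^{\,-1})$, $j=1,\dots,N-1$, be the zero pairs of the autocorrelation polynomial $P_A\bigl[\theta\,e^{\frac{ia}{2b}(\cdot)^2}x\bigr]$. Then each signal $y\in\ell^2(\mathbb{Z})$ with finite support and $|\mathcal{C}_{(a,b,c,d)}[y]|=|\mathcal{C}_{(a,b,c,d)}[x]|$ on $\mathbb{R}$ is of the form $$\mathcal{F}\bigl[\theta\,e^{\frac{ia}{2b}(\cdot)^2}y\bigr](\omega)=e^{i(\alpha+\omega n_0)}\sqrt{\Bigl|\mathrm{a}\bigl[\theta\,e^{\frac{ia}{2b}(\cdot)^2}x\bigr][N-1]\Bigr|\prod_{j=1}^{N-1}|\beta_j|^{-1}}\;\cdot\prod_{j=1}^{N-1}\bigl(e^{-i\omega}-\beta_j\bigr)\qquad(\omega\in\mathbb{R}),$$ where $\alpha\in\mathbb{R}$, $n_0\in\mathbb{Z}$, and $\beta_j$ is chosen from the zero pair $(\gamma_j,\overline{\gamma_j}^{\,-1})$, i.e. $\beta_j\in\{\gamma_j,\overline{\gamma_j}^{\,-1}\}$, for $j=1,\dots,N-1$.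
   Context: For real parameters $a,b,c,d$ with $ad-bc=1$ and $b\ne 0$, the (discrete-time) linear canonical transform of a finitely supported signal $x:\mathbb{Z}\to\mathbb{C}$ (only finitely many $x[n]$ nonzero) is $$\mathcal{C}_{(a,b,c,d)}[x](\omega):=\sum_{n\in\mathbb{Z}}x[n]\,K_{(a,b,c,d)}(\omega,n),\qquad K_{(a,b,c,d)}(\omega,t):=\frac{1}{\sqrt{2\pi b}}\,e^{-i\pi/4}\,e^{\frac{i}{2}\left(\frac{a}{b}t^2-\frac{2}{b}\omega t+\frac{d}{b}\omega^2\right)},\qquad \omega\in\mathbb{R},$$ where for $b<0$ the square root $\sqrt{2\pi b}$ is a fixed (e.g. principal) complex square root. Put $\theta:=\frac{1}{\sqrt{2\pi b}}e^{-i\pi/4}$. The notation $e^{\frac{ia}{2b}(\cdot)^2}x$ denotes the signal $n\mapsto e^{\frac{ia}{2b}n^2}x[n]$. The discrete-time Fourier transform is $\mathcal{F}[x](\omega):=\sum_{n\in\mathbb{Z}}x[n]e^{-i\omega n}$. The support length $N$ of a nonzero finitely supported signal is (largest index with nonzero component) $-$ (smallest index with nonzero component) $+1$. For a finitely supported signal $u$ of support length $N$, the autocorrelation signal and the autocorrelation polynomial are $$\mathrm{a}[u][n]:=\sum_{k\in\mathbb{Z}}\overline{u[k]}\,u[k+n]\quad(n\in\mathbb{Z}),\qquad P_A[u](z):=z^{N-1}\sum_{n=-N+1}^{N-1}\mathrm{a}[u][n]\,z^n .$$ (The autocorrelation signal $\mathrm{a}[\cdot]$ is unrelated to the real parameter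 $a$.) $P_A[u]$ is a polynomial of degree $2N-2$ with $P_A[u](0)\neq0$ whose zeros are symmetric under $z\mapsto\overline{z}^{\,-1}$ (zeros on the unit circle having even multiplicity); its $2N-2$ zeros, counted with multiplicity, are grouped into $N-1$ zero pairs $(\gamma_j,\overline{\gamma_j}^{\,-1})$, $j=1,\dots,N-1$. *)

(* Defs.v *)
From HB Require Import structures.
From mathcomp Require Import all_boot all_order all_algebra.
From mathcomp.real_closed Require Import complex.
From mathcomp Require Import all_classical all_reals all_analysis.

Set Implicit Arguments.
Unset Strict Implicit.
Unset Printing Implicit Defensive.

Import Order.TTheory GRing.Theory Num.Theory.

Local Open Scope classical_set_scope.
Local Open Scope ring_scope.

Section LinearCanonicalTransform.
Variable R : realType.
Implicit Types (a b c d t w : R) (x u : int -> R[i]).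

Definition expi t : R[i] := (cos t +i* sin t)%C.

Definition finitely_supported x : Prop := finite_set [set n : int | x n != 0].

(* [sqrtC] is the principal square root, so this also covers [b < 0]. *)
Definition theta b : R[i] := (sqrtC ((2 * pi * b)%:C)%C)^-1 * expi (- (pi / 4)).

Definition lct_kernel a b c d w t : R[i] :=
  theta b * expi ((a / b * t ^+ 2 - 2 / b * w * t + d / b * w ^+ 2) / 2).

(* [\sum_(n \in A)] is the sum over the support of the summand, which is finite
   for finitely supported signals (and it is 0 if that support is infinite). *)
Definition lct a b c d x w : R[i] :=
  \sum_(n \in [set: int]) x n * lct_kernel a b c d w n%:~R.

Definition chirped a b x : int -> R[i] :=
  fun n => theta b * (expi (a / (2 * b) * n%:~R ^+ 2) * x n).

Definition dtft x w : R[i] :=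
  \sum_(n \in [set: int]) x n * expi (- (w * n%:~R)).

Definition is_support_length u (N : nat) : Prop :=
  exists first last : int,
    [/\ u first != 0, u last != 0,
        forall n, u n != 0 -> first <= n <= last
      & N%:Z = last - first + 1].

(* Only meaningful for nonzero finitely supported signals; 0 otherwise. *)
Definition support_length u : nat := xget 0%N [set N | is_support_length u N].

Definition autocorr u (n : int) : R[i] :=
  \sum_(k \in [set: int]) (u k)^* * u (k + n).

(* The factor z^(N-1) is absorbed by shifting the index: the coefficient of
   'X^k is the autocorrelation at k - (N - 1), for 0 <= k <= 2N - 2. *)
Definition autocorr_poly u : {poly R[i]} :=
  let M := (support_length u).-1 in
  \poly_(k < M.*2.+1) autocorr u (k%:Z - M%:Z).

(* The zeros of p, counted with multiplicity, are exactly the m pairs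
   (g j, 1 / (g j)^* ). *)
Definition zero_pairs (p : {poly R[i]}) (m : nat) (g : 'I_m -> R[i]) : Prop :=
  p = lead_coef p *:
      \prod_(j < m) (('X - (g j)%:P) * ('X - (((g j)^*)^-1)%:P)).

End LinearCanonicalTransform.

(* Main.v *)
(* With u and v the chirped versions of x and y, the kernel factorization gives
   |lct y (b w)| = |dtft v w|, so the hypothesis says that the Laurent polynomials
   of u and v, say z^m p(z) and z^n q(z) with p(0), q(0) nonzero, have the same
   modulus on the unit circle.  There conj (p(z)) = z^(1 - size p) (crev p)(z),
   crev p being the reversed conjugate polynomial, and crev p * p is the
   autocorrelation polynomial of u; since the unit circle is infinite,
   crev p * p = crev q * q.  If the r_k are the roots of q, those of crev q are
   their images under the involution r |-> 1 / conj r, hence the r_k select one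
   element from each zero pair.  Comparing leading coefficients gives the modulus
   of the leading coefficient of q, and its argument is alpha. *)
Require Import Defs.
From mathcomp Require Import all_boot all_order all_algebra.
From mathcomp.real_closed Require Import complex.
From mathcomp Require Import all_classical all_reals all_analysis.
From mathcomp Require Import zify ring.

Set Implicit Arguments.
Unset Strict Implicit.
Unset Printing Implicit Defensive.

Import Order.TTheory GRing.Theory Num.Theory.

Local Open Scope ring_scope.

(** * The unit circle and polynomial identities on it *)

Lemma expiD (R : realType) (s t : R) : expi (s + t) = expi s * expi t.
Proof.
rewrite /expi cosD sinD [_ + cos s * sin t]addrC.
by rewrite -[(_ * _)%R in RHS]/((_ +i* _)%C) [sin s * cos t]mulrC.
Qed.

Lemma expi0 (R : realType) : expi (0 : R) = 1.
Proof. by rewrite /expi cos0 sin0. Qed.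

Lemma norm_expi (R : realType) (t : R) : `|expi t| = 1.
Proof. by rewrite normc_def /= cos2Dsin2 sqrtr1. Qed.

Lemma expi_neq0 (R : realType) (t : R) : expi t != 0.
Proof. by rewrite -normr_eq0 norm_expi oner_eq0. Qed.

Lemma expiMnat (R : realType) (t : R) (n : nat) : expi (t * n%:R) = expi t ^+ n.
Proof.
elim: n => [|n IH]; first by rewrite mulr0 expi0 expr0.
by rewrite -natr1 mulrDr mulr1 expiD IH exprSr.
Qed.

Lemma unit_expi (R : realType) (z : R[i]) :
  `|z| = 1 -> exists t : R, z = expi t.
Proof.
case: z => p q; rewrite normc_def /= => /complexI /(congr1 (fun r => r ^+ 2)).
rewrite expr1n sqr_sqrtr ?addr_ge0 ?sqr_ge0 // => pq1.
have p1 : -1 <= p <= 1.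
  rewrite -ler_norml -(@ler_pXn2r _ 2) ?nnegrE // expr1n real_normK ?num_real //.
  by rewrite -pq1 lerDl sqr_ge0.
have sE : Num.sqrt (1 - p ^+ 2) = `|q| by rewrite -pq1 addrC addKr sqrtr_sqr.
(* [acos] only yields angles with nonnegative sine, so the sign of the imaginary part decides the
   sign of the angle. *)
have [q0|q0] := lerP 0 q.
  by exists (acos p); rewrite /expi acosK ?in_itv //= sin_acos // sE ger0_norm.
exists (- acos p).
by rewrite /expi cosN sinN acosK ?in_itv //= sin_acos // sE ltr0_norm // opprK.
Qed.

Lemma eq_poly_expi (R : realType) (p q : {poly R[i]}) :
  (forall w : R, p.[expi (- w)] = q.[expi (- w)]) -> p = q.
Proof.
move=> pq; apply/eqP; rewrite -subr_eq0; apply: contraT => d0.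
(* The angles 1/(k+1) lie in [0, pi], where [cos] is injective, so these points are distinct roots
   of [p - q], one more than its degree allows. *)
pose s := [seq expi (- (k.+1%:R^-1)) : R[i] | k <- iota 0 (size (p - q))].
suff /(max_poly_roots d0) : all (root (p - q)) s.
  rewrite size_map size_iota ltnn; apply.
  rewrite map_inj_in_uniq ?iota_uniq // => j k _ _ [].
  rewrite !cosN => /cos_inj eq_inv _.
  have I k' : (k'.+1%:R^-1 : R) \in `[0, pi].
    rewrite in_itv /= invr_ge0 ler0n /=.
    apply: (@le_trans _ _ 1); first by rewrite invf_le1 ?ltr0n // ler1n.
    by apply: (le_trans _ (pi_ge2 R)); rewrite ler1n.
  by have /invr_inj/eqP := eq_inv (I j) (I k); rewrite eqr_nat => /eqP [].
apply/allP => z /mapP [k _ ->].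
by rewrite /root hornerD hornerN pq subrr.
Qed.

(** * Conjugate reversal of polynomials and its effect on roots *)

Section ConjugateReversal.
Variable C : numClosedFieldType.
Implicit Types (p : {poly C}) (z : C).

Definition crev p : {poly C} :=
  \sum_(j < size p) (p`_j)^* *: 'X^((size p).-1 - j).

Lemma horner_crev p z : `|z| = 1 -> (crev p).[z] = z ^+ (size p).-1 * (p.[z])^*.
Proof.
move=> z1; rewrite horner_sum horner_coef rmorph_sum mulr_sumr.
apply: eq_bigr => j _; rewrite hornerZ hornerXn rmorphM rmorphXn /= mulrCA.
congr (_ * _).
have zz : z * z^* = 1 by rewrite -normCK z1 expr1n.
have jle : (j <= (size p).-1)%N by case: j => j /=; case: (size p).
(* Split z^deg as z^(deg - j) z^j; the second factor cancels conj(z)^j. *)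
by rewrite -{2}(subnK jle) exprD -mulrA -exprMn zz expr1n mulr1.
Qed.

Lemma horner_crevM p z :
  `|z| = 1 -> (crev p * p).[z] = z ^+ (size p).-1 * `|p.[z]| ^+ 2.
Proof. by move=> z1; rewrite hornerM horner_crev // -mulrA [_^* * _]mulrC -normCK. Qed.

Lemma coef0_crev p : (crev p)`_0 = (lead_coef p)^*.
Proof.
rewrite /crev lead_coefE coef_sum; case sp: (size p) => [|n].
  by rewrite big_ord0 nth_default ?rmorph0 ?sp.
rewrite big_ord_recr /= subnn coefZ coefXn eqxx mulr1 big1 ?add0r // => j _.
by rewrite coefZ coefXn -[_ == _]/(0 == n - j)%N eq_sym subn_eq0 leqNgt ltn_ord mulr0.
Qed.

End ConjugateReversal.

(** On the circle each factor satisfies z conj(z - r) = 1 - conj(r) z = - conj(r) (z - 1/conj(r)),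
    and the constants - conj(r) combine with conj(c) into the conjugate of p(0). Since p(0) is
    nonzero, no root is 0. *)
Lemma crev_prod_XsubC (R : realType) (c : R[i]) (rs : seq R[i]) :
  let p := c *: \prod_(r <- rs) ('X - r%:P) in
  p`_0 != 0 ->
  crev p = (p`_0)^* *: \prod_(r <- rs) ('X - ((r^*)^-1)%:P).
Proof.
move=> p p0.
have c0 : c != 0 by apply: contraNneq p0 => c0; rewrite /p c0 scale0r coef0.
have sp : size p = (size rs).+1 by rewrite size_scale ?size_prod_XsubC.
have p0E : p`_0 = c * \prod_(r <- rs) (- r).
  rewrite -horner_coef0 hornerZ horner_prod; congr (_ * _).
  by apply: eq_bigr => r _; rewrite hornerXsubC sub0r.
have rs0 r : r \in rs -> r != 0.
  move=> rrs; apply: contraNneq p0 => r0.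
  by rewrite p0E (big_rem r) //= r0 oppr0 mul0r mulr0.
apply: eq_poly_expi => w; set z := expi (- w).
have z1 : `|z| = 1 by exact: norm_expi.
have zz : z * z^* = 1 by rewrite -normCK z1 expr1n.
rewrite horner_crev // sp /= p0E !hornerZ !horner_prod !rmorphM !rmorph_prod /=.
rewrite mulrCA -mulrA; congr (_ * _); rewrite -big_split /=.
elim: rs rs0 {p p0 sp p0E} => [|r rs IH] rs0 /=.
  by rewrite !big_nil expr0 mul1r.
rewrite !big_cons -IH; last by move=> s srs; apply: rs0; rewrite inE srs orbT.
rewrite !hornerXsubC rmorphB exprS mulrACA; congr (_ * _).
have r0 : r^* != 0 by rewrite fmorph_eq0 rs0 // mem_head.
by rewrite rmorphN mulrBr zz mulNr mulrBr mulfV // opprB [r^* * z]mulrC.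
Qed.

(** Induction on [gs]: [g] or [f g] occurs in [rs], and removing that element together with its
    image removes the same pair from both multisets. Multiplicities are thereby respected. *)
Lemma perm_eq_involutive_pairs (T : eqType) (f : T -> T) (rs gs : seq T) :
  involutive f -> perm_eq (rs ++ map f rs) (gs ++ map f gs) ->
  exists bs : seq T,
    [/\ perm_eq rs bs, size bs = size gs
      & forall x0 i, nth x0 bs i = nth x0 gs i \/ nth x0 bs i = f (nth x0 gs i)].
Proof.
move=> ff; elim: gs rs => [|g gs IH] rs /= E.
  exists [::]; split=> // [|x0 i]; last by left.
  have := perm_size E.
  by rewrite size_cat /= => /eqP; rewrite addn_eq0 => /andP [/nilP -> _].
have [b brs bg] : exists2 b, b \in rs & (b == g) || (b == f g).
  have : g \in rs ++ map f rs by rewrite (perm_mem E) mem_head.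
  rewrite mem_cat => /orP [grs|/mapP [r rrs ->]]; first by exists g; rewrite ?eqxx.
  by exists r => //; rewrite ff eqxx orbT.
have rsE := perm_to_rem brs.
have swap : perm_eq [:: b; f b] [:: g; f g].
  case/orP: bg => /eqP -> //; rewrite ff.
  by rewrite -[[:: f g; g]]/([:: f g] ++ [:: g]) perm_catC.
have [|bs [rs_bs sbs bs_gs]] := IH (rem b rs).
  (* Counting elements that satisfy an arbitrary [P] turns multiset cancellation into linear
     arithmetic. *)
  apply/permP => P; move/permP/(_ P): E; move/permP/(_ P): swap.
  move/permP/(_ P): (perm_map f rsE); move/permP/(_ P): rsE.
  rewrite !count_cat /= !count_cat /=; lia.
exists (b :: bs); split=> [| |x0 [|i]] /=; first last.
- exact: bs_gs.
- by case/orP: bg => /eqP ->; [left|right].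
- by rewrite sbs.
by apply: (perm_trans rsE); rewrite perm_cons.
Qed.

(** * Finitely supported signals as Laurent polynomials *)

Lemma fsbig_int_window (V : nmodType) (f : int -> V) (n0 : int) (n : nat) :
  (forall k, f k != 0 -> exists2 j : nat, (j < n)%N & k = n0 + j%:Z) ->
  \sum_(k \in [set: int]) f k = \sum_(j < n) f (n0 + j%:Z).
Proof.
move=> supp.
rewrite (@fsbigE _ _ _ _ _ [seq n0 + j%:Z | j <- iota 0 n]).
- rewrite big_map big_mkcond /= -[n in iota 0 n]subn0 big_mkord.
  by apply: eq_bigr => j _; rewrite in_setT.
- by rewrite map_inj_uniq ?iota_uniq // => i j /addrI [].
- by [].
- move=> k _; apply: contraNeq => /supp [j jn ->].
  by apply/mapP; exists j; rewrite ?mem_iota.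
Qed.

(* [u] is the sequence of coefficients of the Laurent polynomial z^n0 p(z). *)
Definition coefs_from (A : nzRingType) (u : int -> A) (n0 : int) (p : {poly A}) :=
  [/\ p`_0 != 0, forall k : nat, u (n0 + k%:Z) = p`_k
    & forall k : int, k < n0 -> u k = 0].

Lemma finitely_supported_coefs_from (R : realType) (u : int -> R[i]) :
  finitely_supported u -> (exists n, u n != 0) -> exists n0 p, coefs_from u n0 p.
Proof.
move=> /finite_seqP [s sE] [m um].
pose B := \max_(n <- s) `|n|%N.
have uB n : u n != 0 -> (`|n| <= B)%N.
  move=> un; have ns : n \in s.
    by have : [set` s]%classic n by rewrite -sE.
  by rewrite /B (big_rem n) //= leq_maxl.
have ex : exists j : nat, u (j%:Z - B%:Z) != 0.
  exists (absz (m + B%:Z)); have := uB _ um => mB.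
  have -> : (absz (m + B%:Z))%:Z - B%:Z = m by lia.
  by [].
case: (ex_minnP ex) => j uj minj.
(* The support lies in [-B, B] and starts at j - B, so 2B + 1 coefficients suffice; minimality of
   [j] makes the constant term nonzero. *)
exists (j%:Z - B%:Z), (\poly_(k < B.*2.+1) u (j%:Z - B%:Z + k%:Z)); split.
- by rewrite coef_poly /= addr0.
- move=> k; rewrite coef_poly; case: ltnP => // kB.
  by apply/eqP; apply: contraTT kB => /uB; lia.
- move=> k kj; apply/eqP; apply: contraT => uk.
  have kB := uB _ uk.
  have kE : (absz (k + B%:Z))%:Z - B%:Z = k by lia.
  by have := minj (absz (k + B%:Z)); rewrite kE => /(_ uk); lia.
Qed.

Section LaurentCoefficients.
Variables (R : realType) (u : int -> R[i]) (n0 : int) (p : {poly R[i]}).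
Hypothesis up : coefs_from u n0 p.

Let p_neq0 : p != 0.
Proof. by case: up => p0 _ _; apply: contraNneq p0 => ->; rewrite coef0. Qed.

Let sizeK : (size p).-1.+1 = size p.
Proof. by rewrite prednK // lt0n size_poly_eq0. Qed.

Lemma coefs_from_supp k : u k != 0 -> exists2 j : nat, (j < size p)%N & k = n0 + j%:Z.
Proof.
case: up => _ uE u0 uk.
have nk : n0 <= k by rewrite leNgt; apply: contraNN uk => /u0 ->.
have kE : k = n0 + (absz (k - n0))%:Z by lia.
exists (absz (k - n0)) => //; rewrite ltnNge; apply: contraNN uk => pk.
by rewrite kE uE nth_default.
Qed.

Lemma coefs_from_support_length : support_length u = size p.
Proof.
case: (up) => p0 uE _.
have H : is_support_length u (size p).
  exists n0, (n0 + (size p).-1%:Z); split.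
  - by have := uE 0%N; rewrite addr0 => ->.
  - by rewrite uE -lead_coefE lead_coef_eq0.
  - by move=> k /coefs_from_supp [j jp ->]; lia.
  - by lia.
(* [xget] may return any admissible length; two pairs of extreme indices bound each other, so the
   length is unique. *)
rewrite /support_length; case: xgetP => [N _ [f [l [uf ul fl NE]]]|/(_ _ H) //].
case: H => f' [l' [uf' ul' fl' NE']].
have := fl _ uf'; have := fl _ ul'; have := fl' _ uf; have := fl' _ ul; lia.
Qed.

Lemma coefs_from_dtft w : dtft u w = expi (- w * n0%:~R) * p.[expi (- w)].
Proof.
case: (up) => _ uE _.
rewrite /dtft (@fsbig_int_window _ _ n0 (size p)); last first.
  move=> k ku; apply: coefs_from_supp; apply: contraNneq ku => ->.
  by rewrite mul0r.
rewrite horner_coef mulr_sumr; apply: eq_bigr => j _.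
rewrite uE mulrCA; congr (_ * _).
by rewrite -mulNr intrD mulrDr expiD -expiMnat.
Qed.

Lemma coefs_from_autocorr_poly : autocorr_poly u = crev p * p.
Proof.
case: (up) => _ uE u0.
rewrite /autocorr_poly coefs_from_support_length /crev mulr_suml.
apply/polyP => k; rewrite coef_poly coef_sum.
have cE (j : 'I_(size p)) : ((p`_j)^* *: 'X^((size p).-1 - j) * p)`_k =
    (p`_j)^* * u (n0 + j%:Z + (k%:Z - (size p).-1%:Z)).
  rewrite -scalerAl coefZ coefXnM; congr (_ * _).
  have jp := ltn_ord j.
  case: ltnP => kj; first by rewrite u0 //; lia.
  rewrite -uE; congr (u _); lia.
(* Past degree 2 (size p - 1) the left side is truncated to 0, and on the right every shifted index
   lies beyond the support. *)
case: ltnP => kp; last first.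
  rewrite big1 // => j _; rewrite cE; apply/eqP; apply: contraT.
  have jp := ltn_ord j.
  by rewrite mulf_eq0 negb_or => /andP [_ /coefs_from_supp [i ip]]; lia.
rewrite /autocorr (@fsbig_int_window _ _ n0 (size p)); last first.
  move=> i; rewrite mulf_eq0 negb_or fmorph_eq0 => /andP [ui _].
  exact: coefs_from_supp.
by apply: eq_bigr => j _; rewrite cE uE.
Qed.

(** At the largest lag, only the first support index is still shifted into the support, onto the
    last one. *)
Lemma coefs_from_autocorr_last :
  autocorr u ((size p)%:Z - 1) = (p`_0)^* * lead_coef p.
Proof.
case: (up) => _ uE _.
rewrite /autocorr (@fsbig_int_window _ _ n0 (size p)); last first.
  move=> i; rewrite mulf_eq0 negb_or fmorph_eq0 => /andP [ui _].
  exact: coefs_from_supp.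
rewrite -sizeK big_ord_recl /= uE big1 ?addr0 => [|i _].
  congr (_ * _); rewrite lead_coefE -uE; congr (u (_ + _)).
  by rewrite intS addrAC subrr add0r.
rewrite /= uE; have -> : n0 + (bump 0 i)%:Z + ((size p).-1.+1%:Z - 1) =
  n0 + (size p + i)%N%:Z by rewrite /bump leq0n sizeK; lia.
by rewrite uE [p`_(size p + i)]nth_default ?leq_addr // mulr0.
Qed.

(** Makes the extreme autocorrelation value depend on the autocorrelation polynomial alone, so it
    can be carried from one signal to the other. *)
Lemma coefs_from_autocorr_poly_last :
  (autocorr_poly u)`_(size p).-1.*2 = (p`_0)^* * lead_coef p.
Proof.
rewrite /autocorr_poly coefs_from_support_length coef_poly ltnSn.
by rewrite -coefs_from_autocorr_last; congr (autocorr u _); have := sizeK; lia.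
Qed.

End LaurentCoefficients.

(** * From equal moduli to a common autocorrelation polynomial and a choice of zeros *)

Lemma eq_support_length (R : realType) (u v : int -> R[i]) :
  (forall n, (u n == 0) = (v n == 0)) -> support_length u = support_length v.
Proof.
move=> uv; rewrite /support_length; congr xget; apply/funext => k; apply/propext.
have sub (u' v' : int -> R[i]) : (forall n, (u' n == 0) = (v' n == 0)) ->
    is_support_length u' k -> is_support_length v' k.
  move=> uv' [f [l [uf ul fl kE]]]; exists f, l.
  by split; rewrite -?uv' // => n; rewrite -uv'; apply: fl.
by split; apply: sub.
Qed.

Lemma mulXn_inj (R : nzRingType) (m n : nat) (p q : {poly R}) :
  p`_0 != 0 -> q`_0 != 0 -> 'X^m * p = 'X^n * q -> m = n.
Proof.
have le m' n' (p' q' : {poly R}) :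
    p'`_0 != 0 -> 'X^m' * p' = 'X^n' * q' -> (n' <= m')%N.
  move=> p0 /polyP /(_ m'); rewrite !coefXnM ltnn subnn => pq.
  by rewrite leqNgt; apply: contraNN p0 => mn; rewrite pq mn.
by move=> p0 q0 pq; apply/eqP; rewrite eqn_leq (le _ _ _ _ p0 pq) (le _ _ _ _ q0 (esym pq)).
Qed.

(** At frequency b w the kernel phase splits into d b w^2 / 2, which is independent of n and
    contributes modulus 1, the chirp a n^2 / (2b), and the Fourier phase - w n. *)
Lemma dtft_lct (R : realType) (a b c d : R) (x : int -> R[i]) (w : R) :
  b != 0 -> finitely_supported x ->
  `|dtft (chirped a b x) w| = `|lct a b c d x (b * w)|.
Proof.
move=> b0 fx.
suff -> : lct a b c d x (b * w) = expi (d * b * w ^+ 2 / 2) * dtft (chirped a b x) w.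
  by rewrite normrM norm_expi mul1r.
rewrite /lct /dtft full_fsbig_distrr.
  apply: eq_fsbigr => n _; rewrite /lct_kernel /chirped.
  have -> : (a / b * n%:~R ^+ 2 - 2 / b * (b * w) * n%:~R + d / b * (b * w) ^+ 2) / 2 =
      d * b * w ^+ 2 / 2 + a / (2 * b) * n%:~R ^+ 2 + - (w * n%:~R) :> R by field.
  rewrite !expiD; set e1 := expi _; set e2 := expi _; set e3 := expi _.
  by rewrite /=; ring.
apply: sub_finite_set fx => n [_ /eqP]; apply: contraNN => /eqP x0.
by rewrite /chirped x0 !mulr0 mul0r.
Qed.

Lemma crevM_eq (R : realType) (p q : {poly R[i]}) :
  p`_0 != 0 -> q`_0 != 0 ->
  (forall w : R, `|p.[expi (- w)]| = `|q.[expi (- w)]|) ->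
  size p = size q /\ crev p * p = crev q * q.
Proof.
move=> p0 q0 pq.
have nz (r : {poly R[i]}) : r`_0 != 0 -> r != 0.
  by move=> r0; apply: contraNneq r0 => ->; rewrite coef0.
have crevM0 (r : {poly R[i]}) : r`_0 != 0 -> (crev r * r)`_0 != 0.
  move=> r0; rewrite -horner_coef0 hornerM !horner_coef0 coef0_crev.
  by rewrite mulf_neq0 // fmorph_eq0 lead_coef_eq0 nz.
(* On the circle each product is z^(size - 1) times a squared modulus, so crossed powers of z are
   needed while the sizes may differ. Nonzero constant terms then force equal powers. *)
have E : 'X^((size q).-1) * (crev p * p) = 'X^((size p).-1) * (crev q * q).
  apply: eq_poly_expi => w.
  have e1 : `|expi (- w)| = 1 by exact: norm_expi.
  rewrite !hornerM !hornerXn -!hornerM !horner_crevM // pq !mulrA.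
  by rewrite [_ ^+ _ * _ ^+ _]mulrC.
have sE := mulXn_inj (crevM0 _ p0) (crevM0 _ q0) E.
have pos (r : {poly R[i]}) : r`_0 != 0 -> (0 < size r)%N.
  by move=> r0; rewrite lt0n size_poly_eq0 nz.
split; first by have := pos _ p0; have := pos _ q0; lia.
by move: E; rewrite sE; apply: mulfI; rewrite monic_neq0 // monicXn.
Qed.

Lemma zero_pairs_choice (R : realType) (m : nat) (gamma : 'I_m -> R[i]) (p : {poly R[i]}) :
  p`_0 != 0 -> zero_pairs (crev p * p) gamma ->
  exists beta : 'I_m -> R[i],
    (forall j, beta j = gamma j \/ beta j = ((gamma j)^*)^-1) /\
    p = lead_coef p *: \prod_(j < m) ('X - (beta j)%:P).
Proof.
move=> p0; rewrite /zero_pairs => E.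
have [rs pE] := closed_field_poly_normal p.
pose f (r : R[i]) := (r^*)^-1.
have ff : involutive f by move=> r; rewrite /f fmorphV invrK /= conjCK.
have crE : crev p = (p`_0)^* *: \prod_(r <- rs) ('X - (f r)%:P).
  by rewrite {1}pE crev_prod_XsubC -?pE.
pose gs := [seq gamma j | j <- enum 'I_m].
have lead0 : lead_coef p != 0.
  by rewrite lead_coef_eq0; apply: contraNneq p0 => ->; rewrite coef0.
have : perm_eq (rs ++ map f rs) (gs ++ map f gs).
  have prE : crev p * p = ((p`_0)^* * lead_coef p) *:
      (\prod_(r <- rs ++ map f rs) ('X - r%:P)).
    rewrite crE {2}pE -scalerAl -scalerAr scalerA big_cat big_map /=.
    by rewrite [X in _ *: X]mulrC.
  (* Both root lists factor the same polynomial; once the common nonzero leading coefficient is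
     cancelled, they agree up to order. *)
  apply: prod_XsubC_eq; move: E.
  rewrite [in lead_coef _]prE lead_coefZ lead_coef_prod_XsubC mulr1 prE.
  move/(scalerI (mulf_neq0 _ lead0)) => ->; last by rewrite fmorph_eq0.
  have gE (F : R[i] -> {poly R[i]}) : \prod_(r <- gs) F r = \prod_(j < m) F (gamma j).
    by rewrite (big_map gamma) big_enum.
  by rewrite big_split big_cat (big_map f) !gE.
move=> /(perm_eq_involutive_pairs ff) [bs [rs_bs sbs bs_gs]].
have sgs : size gs = m by rewrite size_map size_enum_ord.
exists (fun j => bs`_j); split=> [j|].
  have gE : gs`_j = gamma j by rewrite (nth_map j) ?size_enum_ord // nth_ord_enum.
  by have := bs_gs 0 j; rewrite gE.
by rewrite {1}pE; congr (_ *: _); rewrite (perm_big _ rs_bs) /= (big_nth 0) sbs sgs big_mkord.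
Qed.

Lemma chirped_eq0 (R : realType) (a b : R) (x : int -> R[i]) (n : int) :
  b != 0 -> (chirped a b x n == 0) = (x n == 0).
Proof.
move=> b0; rewrite /chirped /theta !mulf_eq0 invr_eq0 sqrtC_eq0 !(negbTE (expi_neq0 _)).
suff -> : ((2 * pi * b)%:C%C == 0 :> R[i]) = false by [].
by apply/negbTE; rewrite fmorph_eq0 !mulf_neq0 ?pnatr_eq0 // gt_eqF ?pi_gt0.
Qed.

Lemma chirped_finitely_supported (R : realType) (a b : R) (x : int -> R[i]) :
  b != 0 -> finitely_supported x -> finitely_supported (chirped a b x).
Proof. by move=> b0; apply: sub_finite_set => n /=; rewrite chirped_eq0. Qed.

Theorem theorem4p2 (R : realType) (a b c d : R)
    (hdet : a * d - b * c = 1) (hb : b != 0)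
    (x : int -> R[i]) (N : nat)
    (hx : finitely_supported x) (hx0 : exists n, x n != 0)
    (hN : support_length x = N)
    (gamma : 'I_N.-1 -> R[i])
    (hgamma : zero_pairs (autocorr_poly (chirped a b x)) gamma)
    (y : int -> R[i]) (hy : finitely_supported y)
    (hxy : forall w : R, `|lct a b c d y w| = `|lct a b c d x w|) :
  exists (alpha : R) (n0 : int) (beta : 'I_N.-1 -> R[i]),
    (forall j, beta j = gamma j \/ beta j = ((gamma j)^*)^-1) /\
    (forall w : R,
       dtft (chirped a b y) w =
         expi (alpha + w * n0%:~R)
         * sqrtC (`|autocorr (chirped a b x) (N%:Z - 1)|
                  * \prod_(j < N.-1) `|beta j|^-1)
         * \prod_(j < N.-1) (expi (- w) - beta j)).
Proof.
have uv w : `|dtft (chirped a b y) w| = `|dtft (chirped a b x) w|.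
  by rewrite !(dtft_lct a c d) // hxy.
have [|n1 [p up]] := finitely_supported_coefs_from (chirped_finitely_supported a hb hx).
  by have [n xn] := hx0; exists n; rewrite chirped_eq0.
have p0 : p`_0 != 0 by case: up.
(* If [y] vanished, [p] would be zero on the whole circle, contradicting p(0) nonzero. *)
have y0 : exists n, y n != 0.
  apply: contrapT => /forallNP y0; case/negP: p0.
  suff -> : p = 0 by rewrite coef0.
  apply: eq_poly_expi => w; rewrite horner0.
  have : `|dtft (chirped a b x) w| = 0.
    rewrite -uv /dtft fsbig1 ?normr0 // => n _.
    by have /negP/negPn/eqP := y0 n; rewrite /chirped => ->; rewrite !mulr0 mul0r.
  rewrite (coefs_from_dtft up) => /eqP.
  by rewrite normr_eq0 mulf_eq0 (negbTE (expi_neq0 _)) => /eqP.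
have [|n2 [q vq]] := finitely_supported_coefs_from (chirped_finitely_supported a hb hy).
  by have [n yn] := y0; exists n; rewrite chirped_eq0.
have q0 : q`_0 != 0 by case: vq.
have [w|spq pq] := crevM_eq p0 q0.
  by have := uv w; rewrite (coefs_from_dtft up) (coefs_from_dtft vq) !normrM !norm_expi !mul1r.
move: hgamma; rewrite (coefs_from_autocorr_poly up) pq => /(zero_pairs_choice q0).
move=> [beta [beta_gamma qE]].
have NE : N = size p.
  rewrite -hN -(coefs_from_support_length up); apply: eq_support_length => n.
  by rewrite chirped_eq0.
have lead0 : lead_coef q != 0.
  by rewrite lead_coef_eq0; apply: contraNneq q0 => ->; rewrite coef0.
have q0E : `|q`_0| = `|lead_coef q| * \prod_(j < N.-1) `|beta j|.
  rewrite {1}qE -horner_coef0 hornerZ horner_prod normrM normr_prod; congr (_ * _).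
  by apply: eq_bigr => j _; rewrite hornerXsubC sub0r normrN.
have beta0 : \prod_(j < N.-1) `|beta j| != 0.
  by apply: contraNneq q0 => b0; rewrite -normr_eq0 q0E b0 mulr0.
have -> : autocorr (chirped a b x) (N%:Z - 1) = (q`_0)^* * lead_coef q.
  rewrite NE (coefs_from_autocorr_last up) -(coefs_from_autocorr_poly_last up).
  rewrite -(coefs_from_autocorr_poly_last vq).
  by rewrite (coefs_from_autocorr_poly up) (coefs_from_autocorr_poly vq) pq spq.
(* By [q0E] the product of the moduli of the [beta j] cancels, leaving the square of the modulus of
   the leading coefficient. *)
have sqE : sqrtC (`|(q`_0)^* * lead_coef q| * \prod_(j < N.-1) `|beta j|^-1) = `|lead_coef q|.
  rewrite normrM norm_conjC q0E prodfV.
  by rewrite [_ * _ * `|lead_coef q|]mulrAC mulfK // -expr2 sqrCK.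
have [alpha leadE] : exists alpha : R, lead_coef q = expi alpha * `|lead_coef q|.
  have [|alpha alphaE] := @unit_expi _ (lead_coef q / `|lead_coef q|).
    by rewrite normrM normfV normr_id mulfV ?normr_eq0.
  by exists alpha; rewrite -alphaE divfK ?normr_eq0.
(* The factor z^n2 at z = e^(-iw) is e^(-i w n2), hence the sign of the shift. *)
exists alpha, (- n2), beta; split=> // w.
rewrite sqE (coefs_from_dtft vq) {1}qE hornerZ horner_prod [in LHS]leadE.
under eq_bigr do rewrite hornerXsubC.
rewrite [alpha + _]addrC expiD mulrNz mulrN mulNr.
by rewrite !mulrA.
Qed.
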